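(* Let $N\ge2$ and let $F=F(N,\mathcal D)$ be a connected GSC with $|\mathcal D|>N$. Then $|\mathcal D|\ge 2N-1$. Conversely, for every integer $k\ge2N-1$ with $k\le N^2-1$, and for $k=N$, there exists a digit set $\mathcal D\subset\{0,\dots,N-1\}^2$ with $|\mathcal D|=k$ such that $F(N,\mathcal D)$ is connected.
   Context: GSC: $N\ge2$, $\mathcal D\subset\{0,\dots,N-1\}^2$ with $1<|\mathcal D|<N^2$, $\varphi_i(x)=\frac1N(x+i)$, and $F(N,\mathcal D)$ is the unique nonempty compact set with $F=\bigcup_{i\in\mathcal D}\varphi_i(F)$. *)

(* Defs.v *)
From HB Require Import structures.
From mathcomp Require Import all_boot all_order all_algebra.
From mathcomp Require Import all_classical all_reals all_analysis.
Set Implicit Arguments. Unset Strict Implicit. Unset Printing Implicit Defensive.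
Import Order.TTheory GRing.Theory Num.Theory.
Import numFieldNormedType.Exports.
Local Open Scope classical_set_scope.
Local Open Scope ring_scope.

Definition gsc_map (R : realType) (N : nat) (i : 'I_N * 'I_N) (x : R * R) : R * R :=
  ((x.1 + (nat_of_ord i.1)%:R) / N%:R, (x.2 + (nat_of_ord i.2)%:R) / N%:R).

Definition gsc_digits (N : nat) (D : {set 'I_N * 'I_N}) : Prop :=
  (2 <= N)%N /\ (1 < #|D|)%N /\ (#|D| < N ^ 2)%N.

(* F is the GSC F(N,D): a nonempty compact subset of R^2 with
   F = \bigcup_{i in D} phi_i(F) (it exists and is unique by Hutchinson). *)
Definition is_gsc_attractor (R : realType) (N : nat) (D : {set 'I_N * 'I_N})
    (F : set (R * R)) : Prop :=
  F !=set0 /\ compact F /\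
  F = \bigcup_(i in [set i | i \in D]) (@gsc_map R N i @` F).

(* Main.v *)
(* Lower bound.  Join two digits when their pieces of F meet; this graph is
   connected because F is.  A horizontal step is possible only if F meets both
   vertical sides of the unit square at a common height, which puts digits in
   both extreme columns; a diagonal step forces two opposite corners into D.
   These digits are the ends of two paths in the graph.  If the paths are
   disjoint, counting is immediate; otherwise, with M and M' the first and last
   vertex of the second path on the first one, the five arcs between ends, M and
   M' meet only at M and M', and lower bounds on their lengths (in the sup norm,
   one of two hexagonal norms, or the l^1 norm, according to which diagonal
   steps occur) add up to 2N - 2.

   Existence.  Take the bottom row, alone or with the left column and further
   digits added so that D stays closed to the left.  The pieces then form a
   connected graph, and F is connected by self-similarity: a subset of F that is
   stable under moves smaller than eps meets each piece in nothing or in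
   everything as soon as this holds on F for moves smaller than N eps. *)

Require Import Defs.
From HB Require Import structures.
From mathcomp Require Import all_boot all_order all_algebra.
From mathcomp Require Import all_classical all_reals all_analysis.
From mathcomp Require Import zify ring lra.
Import numFieldNormedType.Exports.

Set Implicit Arguments.
Unset Strict Implicit.
Unset Printing Implicit Defensive.
Import Order.TTheory GRing.Theory Num.Theory.

(** * Left-closed digit sets of prescribed size *)

Definition cx (N : nat) (i : 'I_N * 'I_N) : nat := i.1.
Definition cy (N : nat) (i : 'I_N * 'I_N) : nat := i.2.

(** Every row of such a set is an initial segment, so each cell can be joined to the left column by
    horizontal steps inside the set. *)
Definition left_closed (N : nat) (D : {set 'I_N * 'I_N}) : Prop :=
  forall i j, i \in D -> cy j = cy i -> cx j < cx i -> j \in D.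

Definition bottom_row (N : nat) : {set 'I_N * 'I_N} := [set i | cy i == 0].
Definition left_column (N : nat) : {set 'I_N * 'I_N} := [set i | cx i == 0].

Lemma card_bottom_row (N : nat) : 0 < N -> #|bottom_row N| = N.
Proof.
case: N => // N _.
have -> : bottom_row N.+1 = finset.setX [set: 'I_N.+1] [set ord0].
  by apply/setP => -[i j]; rewrite !inE.
by rewrite cardsX cardsT card_ord cards1 muln1.
Qed.

Lemma card_left_column (N : nat) : 0 < N -> #|left_column N| = N.
Proof.
case: N => // N _.
have -> : left_column N.+1 = finset.setX [set ord0] [set: 'I_N.+1].
  by apply/setP => -[i j]; rewrite !inE andbT.
by rewrite cardsX cardsT card_ord cards1 mul1n.
Qed.

Lemma card_corner_shape (N : nat) : 0 < N ->
  #|bottom_row N :|: left_column N| = 2 * N - 1.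
Proof.
move=> N0; rewrite cardsU card_bottom_row// card_left_column//.
have -> : #|bottom_row N :&: left_column N| = 1; last by lia.
case: N N0 => // N _; apply/eqP/cards1P; exists (ord0, ord0).
by apply/setP => -[i j]; rewrite !inE andbC xpair_eqE.
Qed.

Lemma left_closed_bottom_row N : left_closed (bottom_row N).
Proof. by move=> i j; rewrite !inE => iD ->. Qed.

(** The union of the bottom row and the left column has [2 * N - 1] cells and starts an induction
    that adds one missing cell at a time. *)
Lemma left_closed_exists (N k : nat) : 0 < N -> 2 * N - 1 <= k -> k <= N ^ 2 ->
  exists D : {set 'I_N * 'I_N}, [/\ left_closed D,
    bottom_row N \subset D, left_column N \subset D & #|D| = k].
Proof.
move=> N0; elim: k => [|k IHk]; first by lia.
rewrite leq_eqVlt => /predU1P[kE _|Nk kN].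
  exists (bottom_row N :|: left_column N); rewrite card_corner_shape// kE.
  rewrite finset.subsetUl finset.subsetUr.
  split=> // i j; rewrite !inE => /orP[/eqP i0 ->|/eqP -> //]; by rewrite i0 eqxx.
have [D [lD bD cD Dk]] := IHk Nk (ltnW kN).
have [i0 i0D] : exists i0, i0 \notin D.
  apply/existsP; rewrite -negb_forall; apply/negP => /forallP allD.
  have DT : D = [set: 'I_N * 'I_N] by apply/setP => i; rewrite inE allD.
  by move: kN; rewrite -Dk DT cardsT card_prod !card_ord; lia.
(* Taking the new cell in the least possible column ensures that all cells to its left are already
   in [D]. *)
pose j := [arg min_(i < i0 in ~: D) cx i].
have [jD minj] : j \notin D /\ forall i, i \notin D -> cx j <= cx i.
  rewrite /j; case: arg_minnP => [|i]; first by rewrite inE.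
  by rewrite inE => iD mini; split=> // i' i'D; apply: mini; rewrite inE.
exists (j |: D); rewrite cardsU1 jD Dk; split=> //.
- move=> i i' /finset.setU1P[-> _ i'j|iD ii' i'i].
    apply/finset.setU1P; right; apply/negPn/negP => /minj; lia.
  by apply/finset.setU1P; right; apply: lD iD ii' i'i.
- exact: fintype.subset_trans bD (finset.subsetUr _ _).
- exact: fintype.subset_trans cD (finset.subsetUr _ _).
Qed.

Local Open Scope classical_set_scope.

(** * Two paths in a finite graph *)

Definition walk (T : eqType) (e : rel T) (n : nat) (x y : T) : Prop :=
  exists p, [/\ path e x p, last x p = y & size p = n].

Lemma walk_ind (T : eqType) (e : rel T) (P : nat -> T -> T -> Prop) :
  (forall x, P 0 x x) ->
  (forall n x y z, e x y -> P n y z -> P n.+1 x z) ->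
  forall n x y, walk e n x y -> P n x y.
Proof.
move=> P0 PS n x y [p []]; elim: p n x => [|z p IHp] n x /=.
  by move=> _ -> <-; apply: P0.
by move=> /andP[xz zp] lastp <-; apply: PS xz _; apply: IHp.
Qed.

Lemma first_meeting (T : eqType) (e : rel T) (S : {pred T}) x p :
  path e x p -> has [in S] (x :: p) ->
  exists p1 p2, [/\ p = p1 ++ p2, last x p1 \in S &
    ~~ has [in S] (belast x p1)].
Proof.
elim: p x => [|y p IHp] x /=.
  by rewrite orbF => _ xS; exists [::], [::].
move=> /andP[xy yp]; have [xS _|xS /= ypS] := boolP (x \in S).
  by exists [::], (y :: p).
have [p1 [p2 [-> lastS Np1]]] := IHp y yp ypS.
by exists (y :: p1), p2; split=> //=; rewrite negb_or xS.
Qed.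

Lemma last_meeting (T : eqType) (e : rel T) (S : {pred T}) x p :
  path e x p -> x \in S ->
  exists p1 p2, [/\ p = p1 ++ p2, last x p1 \in S & ~~ has [in S] p2].
Proof.
elim/last_ind: p => [|p y IHp] in x *.
  by move=> _ xS; exists [::], [::].
rewrite rcons_path => /andP[xp py] xS; have [yS|yS] := boolP (y \in S).
  by exists (rcons p y), [::]; rewrite cats0 last_rcons.
have [p1 [p2 [-> lastS Np2]]] := IHp x xp xS.
exists p1, (rcons p2 y); split=> //; first by rewrite rcons_cat.
by rewrite has_rcons negb_or yS.
Qed.

(** The order of [y] and [z] along the path is not known, hence the two alternatives. *)
Lemma walk_split2 (T : eqType) (e : rel T) x p y z :
  path e x p -> y \in x :: p -> z \in x :: p ->
  exists n1 n2 n3, n1 + n2 + n3 = size p /\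
   ([/\ walk e n1 x y, walk e n2 y z & walk e n3 z (last x p)] \/
    [/\ walk e n1 x z, walk e n2 z y & walk e n3 y (last x p)]).
Proof.
move=> xp yp zp; move: xp zp.
case/splitPl: yp => p1 p2 <-; rewrite cat_path => /andP[xp1 p1p2].
rewrite -cat_cons mem_cat => /orP[zp1|zp2].
  move: xp1 p1p2; case/splitPl: zp1 => p3 p4 <-.
  rewrite cat_path => /andP[xp3 p3p4] p4p2.
  exists (size p3), (size p4), (size p2); rewrite !size_cat; split=> //.
  right; split; [by exists p3|by exists p4; rewrite last_cat|].
  by exists p2; split=> //; rewrite !last_cat.
have {}zp2 : z \in last x p1 :: p2 by rewrite inE zp2 orbT.
move: p1p2; case/splitPl: zp2 => p3 p4 <-.
rewrite cat_path => /andP[p1p3 p3p4].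
exists (size p1), (size p3), (size p4); rewrite !size_cat addnA; split=> //.
left; split; [by exists p1|by exists p3|].
by exists p4; split=> //; rewrite !last_cat.
Qed.

(** After shortening, no path repeats a vertex. If the paths meet, the whole first path and the
    parts of the second before its first and after its last common vertex are pairwise disjoint. The
    last two cases differ in the order in which the first path visits [M] and [M']. *)
Lemma two_paths (T : finType) (e : rel T) (D : {set T}) (A B C E : T) :
  (forall x y, e x y -> y \in D) -> A \in D -> C \in D ->
  connect e A B -> connect e C E ->
  [\/ exists n1 n2, [/\ n1 + n2 + 2 <= #|D|, walk e n1 A B & walk e n2 C E],
      exists M M' n1 n2 n3 n4 n5, [/\ n1 + n2 + n3 + n4 + n5 < #|D|,
        walk e n4 C M, walk e n5 M' E &
        [/\ walk e n1 A M, walk e n2 M M' & walk e n3 M' B]] |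
      exists M M' n1 n2 n3 n4 n5, [/\ n1 + n2 + n3 + n4 + n5 < #|D|,
        walk e n4 C M, walk e n5 M' E &
        [/\ walk e n1 A M', walk e n2 M' M & walk e n3 M B]]].
Proof.
move=> eD AD CD /connectP[p0 Ap0 ->] /connectP[q0 Cq0 ->].
case/shortenP: Ap0 => p Ap uniqp _ {p0}; case/shortenP: Cq0 => q Cq uniqq _ {q0}.
have pathD x s : x \in D -> path e x s -> {subset x :: s <= D}.
  elim: s x => [|y s IHs] x xD /=; first by move=> _ z; rewrite inE => /eqP ->.
  move=> /andP[/eD yD ys] z; rewrite inE => /predU1P[->//|]; exact: IHs.
have cardD s : uniq s -> {subset s <= D} -> size s <= #|D|.
  by move=> us sD; rewrite -(card_uniqP us); apply/subset_leq_card/fintype.subsetP.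
have [qp|qp] := boolP (has [in A :: p] (C :: q)); last first.
  apply: Or31; exists (size p), (size q); split; [|by exists p|by exists q].
  have -> : size p + size q + 2 = size ((A :: p) ++ (C :: q)).
    by rewrite size_cat /=; lia.
  apply: cardD; first by rewrite cat_uniq uniqp qp.
  by move=> z; rewrite mem_cat => /orP[]; [exact: pathD Ap z|exact: pathD Cq z].
have [q1 [q2 [qE Mp Nq1]]] := first_meeting Cq qp.
move: Cq; rewrite qE cat_path => /andP[Cq1 q1q2].
have [q3 [q4 [q2E M'p Nq4]]] := last_meeting q1q2 Mp.
move: q1q2; rewrite q2E cat_path => /andP[q1q3 q3q4].
set M := last C q1 in Mp q1q3 q3q4 M'p *; set M' := last M q3 in M'p q3q4 *.
have lastq : last C (q1 ++ q3 ++ q4) = last M' q4 by rewrite !last_cat.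
(* The part [q3] of the second path is not counted, since it may meet the first path again. The
   inequality is strict because [p] comes with its start [A]. *)
have szD : size p + size q1 + size q4 < #|D|.
  have -> : (size p + size q1 + size q4).+1 = size (belast C q1 ++ (A :: p) ++ q4).
    by rewrite !size_cat size_belast /= addnCA addnA !addSn.
  have subq : {subset belast C q1 ++ q4 <= C :: q}.
    move=> z; rewrite mem_cat qE q2E -cat_cons lastI cat_rcons -cat_cons !mem_cat.
    by case/orP => ->; rewrite ?orbT.
  apply: cardD; last first.
    move=> z; rewrite !mem_cat => /or3P[z1|z1|z1].
    - apply: (pathD C q) => //; first by rewrite qE q2E !cat_path Cq1 q1q3.
      by apply: subq; rewrite mem_cat z1.
    - exact: (pathD A p).
    - apply: (pathD C q) => //; first by rewrite qE q2E !cat_path Cq1 q1q3.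
      by apply: subq; rewrite mem_cat z1 orbT.
  have : uniq (belast C q1 ++ q4).
    move: uniqq; rewrite qE q2E -cat_cons lastI cat_rcons -cat_cons.
    by apply: subseq_uniq; rewrite cat_subseq ?suffix_subseq.
  rewrite uniq_catCA.
  rewrite [uniq ((A :: p) ++ _)]cat_uniq uniqp => -> /=; rewrite andbT has_cat negb_or.
  by rewrite Nq1.
have [n1 [n2 [n3 [sz []] [w1 w2 w3]]]] := walk_split2 Ap Mp M'p;
  [apply: Or32|apply: Or33]; exists M, M', n1, n2, n3, (size q1), (size q4);
  rewrite ?lastq; (split; [by rewrite sz|by exists q1|by exists q4|by split]).
Qed.

(** With [W] a distance estimate satisfied by all walks, the graph disappears and only arithmetic on
    coordinates is left. *)
Lemma two_paths_bound (T : finType) (e : rel T) (D : {set T}) (A B C E : T)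
    (W : nat -> T -> T -> Prop) (m : nat) :
  (forall x y, e x y -> y \in D) -> A \in D -> C \in D ->
  connect e A B -> connect e C E ->
  (forall n x y, walk e n x y -> W n x y) ->
  (forall n1 n2, W n1 A B -> W n2 C E -> m <= n1 + n2 + 2) ->
  (forall M M' n1 n2 n3 n4 n5, W n1 A M -> W n2 M M' -> W n3 M' B ->
    W n4 C M -> W n5 M' E -> m <= (n1 + n2 + n3 + n4 + n5).+1) ->
  (forall M M' n1 n2 n3 n4 n5, W n1 A M' -> W n2 M' M -> W n3 M B ->
    W n4 C M -> W n5 M' E -> m <= (n1 + n2 + n3 + n4 + n5).+1) ->
  m <= #|D|.
Proof.
move=> eD AD CD AB CE eW disj fwd bwd.
have [[n1 [n2 [le /eW w1 /eW w2]]]|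
  [M [M' [n1 [n2 [n3 [n4 [n5 [le /eW w4 /eW w5 [/eW w1 /eW w2 /eW w3]]]]]]]]]|
  [M [M' [n1 [n2 [n3 [n4 [n5 [le /eW w4 /eW w5 [/eW w1 /eW w2 /eW w3]]]]]]]]]]
  := two_paths eD AD CD AB CE.
- exact: leq_trans (disj _ _ w1 w2) le.
- exact: leq_trans (fwd _ _ _ _ _ _ _ w1 w2 w3 w4 w5) le.
- exact: leq_trans (bwd _ _ _ _ _ _ _ w1 w2 w3 w4 w5) le.
Qed.

(** * Combinatorial conditions for two pieces to meet *)

Definition is_cell (N : nat) (D : {set 'I_N * 'I_N}) (a b : nat) : Prop :=
  exists2 i, i \in D & (cx i = a) /\ (cy i = b).

(* Weaker than F meeting F + (1, 0), but all that the counting needs. *)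
Definition row_linked (N : nat) (D : {set 'I_N * 'I_N}) : Prop :=
  (exists a b, [/\ is_cell D 0 a, is_cell D N.-1 b & b <= a]) /\
  (exists a b, [/\ is_cell D 0 a, is_cell D N.-1 b & a <= b]).

Definition col_linked (N : nat) (D : {set 'I_N * 'I_N}) : Prop :=
  (exists a b, [/\ is_cell D a 0, is_cell D b N.-1 & b <= a]) /\
  (exists a b, [/\ is_cell D a 0, is_cell D b N.-1 & a <= b]).

(** Diagonal neighbours share a single point, which is (0, 0) seen from one cell and (1, 1) seen
    from the other. These points lie in the attractor exactly when the corresponding corner digits
    are in [D]. *)
Definition diag_linked (N : nat) (D : {set 'I_N * 'I_N}) : Prop :=
  is_cell D 0 0 /\ is_cell D N.-1 N.-1.

Definition antidiag_linked (N : nat) (D : {set 'I_N * 'I_N}) : Prop :=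
  is_cell D 0 N.-1 /\ is_cell D N.-1 0.

Definition row_step (N : nat) (i j : 'I_N * 'I_N) : Prop :=
  cy i = cy j /\ (cx i = (cx j).+1 \/ cx j = (cx i).+1).

Definition col_step (N : nat) (i j : 'I_N * 'I_N) : Prop :=
  cx i = cx j /\ (cy i = (cy j).+1 \/ cy j = (cy i).+1).

Definition diag_step (N : nat) (i j : 'I_N * 'I_N) : Prop :=
  (cx i = (cx j).+1 /\ cy i = (cy j).+1) \/
  (cx j = (cx i).+1 /\ cy j = (cy i).+1).

Definition antidiag_step (N : nat) (i j : 'I_N * 'I_N) : Prop :=
  (cx i = (cx j).+1 /\ cy j = (cy i).+1) \/
  (cx j = (cx i).+1 /\ cy i = (cy j).+1).

(** This keeps only what the counting needs of two pieces of F meeting, so that no real numbers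
    enter the lower bound. *)
Inductive linked (N : nat) (D : {set 'I_N * 'I_N}) (i j : 'I_N * 'I_N) : Prop :=
| LinkedRefl of i = j
| LinkedRow of row_step i j & row_linked D
| LinkedCol of col_step i j & col_linked D
| LinkedDiag of diag_step i j & diag_linked D
| LinkedAntidiag of antidiag_step i j & antidiag_linked D.

Lemma connect_invariant (T : finType) (U : Type) (e : rel T) (f : T -> U) :
  (forall x y, e x y -> f x = f y) -> forall x y, connect e x y -> f x = f y.
Proof.
move=> ef x y /connectP[p + ->]; elim: p x => //= z p IHp x /andP[xz zp].
by rewrite (ef _ _ xz) (IHp _ zp).
Qed.

Lemma card_le_inj (N : nat) (D : {set 'I_N * 'I_N}) (f : 'I_N * 'I_N -> 'I_N) :
  {in D &, injective f} -> #|D| <= N.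
Proof. by move=> /card_in_imset <-; rewrite -[X in _ <= X]card_ord max_card. Qed.

(** * Counting cells with norms adapted to the allowed steps *)

Section LowerBound.
Context (N : nat) (D : {set 'I_N * 'I_N}) (e : rel ('I_N * 'I_N)).
Context (eD : forall i j, e i j -> j \in D).
Context (conn : {in D &, forall i j, connect e i j}).
Context (e_linked : forall i j, e i j -> linked D i j).

(** Ball of the sup norm; additions replace differences, which would be truncated in [nat]. *)
Definition king_near (n : nat) (x y : 'I_N * 'I_N) : Prop :=
  [/\ cx x <= cx y + n, cx y <= cx x + n, cy x <= cy y + n & cy y <= cy x + n].

(** Ball of the hexagonal norm max(|dx|, |dy|, |dx - dy|), in which a diagonal step has length 1 and
    an antidiagonal one length 2. [antihex_near] is its mirror image. *)
Definition hex_near (n : nat) (x y : 'I_N * 'I_N) : Prop :=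
  king_near n x y /\ (cx x + cy y <= cx y + cy x + n /\ cx y + cy x <= cx x + cy y + n).

Definition antihex_near (n : nat) (x y : 'I_N * 'I_N) : Prop :=
  king_near n x y /\ (cx x + cy x <= cx y + cy y + n /\ cx y + cy y <= cx x + cy x + n).

Lemma king_walk n x y : walk e n x y -> king_near n x y.
Proof.
rewrite /king_near.
move: n x y; apply: walk_ind => [x|n x y z /e_linked xy] /=; first by split; lia.
move=> [? ? ? ?].
case: xy => [->|[? ?] _|[? ?] _|[[? ?]|[? ?]] _|[[? ?]|[? ?]] _]; split; lia.
Qed.

Lemma hex_walk : ~ antidiag_linked D -> forall n x y, walk e n x y -> hex_near n x y.
Proof.
move=> ND n x y w; split; first exact: king_walk.
move: n x y w; apply: walk_ind => [x|n x y z /e_linked xy] /=; first by split; lia.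
move=> [? ?].
case: xy => [->|[? ?] _|[? ?] _|[[? ?]|[? ?]] _|_ /ND //]; split; lia.
Qed.

Lemma antihex_walk : ~ diag_linked D -> forall n x y, walk e n x y -> antihex_near n x y.
Proof.
move=> ND n x y w; split; first exact: king_walk.
move: n x y w; apply: walk_ind => [x|n x y z /e_linked xy] /=; first by split; lia.
move=> [? ?].
case: xy => [->|[? ?] _|[? ?] _|_ /ND //|[[? ?]|[? ?]] _]; split; lia.
Qed.

(* The two hexagonal bounds together bound the l^1 distance. *)
Lemma square_walk : ~ diag_linked D -> ~ antidiag_linked D ->
  forall n x y, walk e n x y -> hex_near n x y /\ antihex_near n x y.
Proof. by move=> ND NA n x y w; split; [exact: hex_walk|exact: antihex_walk]. Qed.

Ltac near_lia := rewrite /hex_near /antihex_near /king_near; intros;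
  repeat match goal with
  | H : _ /\ _ |- _ => destruct H
  | H : and4 _ _ _ _ |- _ => destruct H
  end; lia.

(** Adjacent corners are at sup distance N - 1. The four outer arcs join two disjoint pairs of
    adjacent corners, through [M] and through [M'], hence have total length at least 2(N - 1). *)
Lemma lower_bound_full : diag_linked D -> antidiag_linked D -> 2 * N - 1 <= #|D|.
Proof.
move=> [[A AD [A1 A2]] [B BD [B1 B2]]] [[C CD [C1 C2]] [E ED [E1 E2]]].
apply: (two_paths_bound eD AD CD (conn AD BD) (conn CD ED) king_walk); near_lia.
Qed.

(** In the row case, with M = (x, y) and M' = (x', y'), the hexagonal norm gives n1 + n4 >= x + a,
    n2 >= x' - x and n3 + n5 >= 2(N - 1) - x' - b when [M] comes first; [b <= a] then suffices.
    Otherwise the outer arcs join [A] to [E] and [C] to [B], each pair at distance at least N -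
    1. *)
Lemma lower_bound_diag : ~ antidiag_linked D -> diag_linked D ->
  row_linked D \/ col_linked D -> 2 * N - 1 <= #|D|.
Proof.
move=> NA [[A AD [A1 A2]] [B BD [B1 B2]]] [] [[a [b [[C CD [C1 C2]] [E ED [E1 E2]] ab]]] _];
apply: (two_paths_bound eD AD CD (conn AD BD) (conn CD ED) (hex_walk NA)); near_lia.
Qed.

(** The reflection y -> N - 1 - y leads back to the diagonal case. It reverses inequalities between
    rows and exchanges bottom and top, so the second halves of [row_linked] and [col_linked] are
    taken. *)
Lemma lower_bound_antidiag : ~ diag_linked D -> antidiag_linked D ->
  row_linked D \/ col_linked D -> 2 * N - 1 <= #|D|.
Proof.
move=> ND [[A AD [A1 A2]] [B BD [B1 B2]]].
case=> [[_ [a [b [[C CD [C1 C2]] [E ED [E1 E2]] ab]]]]|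
        [_ [a [b [[C CD [C1 C2]] [E ED [E1 E2]] ab]]]]].
  by apply: (two_paths_bound eD AD CD (conn AD BD) (conn CD ED) (antihex_walk ND)); near_lia.
(* The vertical path is taken from top to bottom, as the reflection requires. *)
by apply: (two_paths_bound eD AD ED (conn AD BD) (conn ED CD) (antihex_walk ND)); near_lia.
Qed.

(** Only the extreme columns and rows of the ends matter. In the l^1 norm the middle arc counts for
    its width plus its height, and so serves both the horizontal and the vertical crossing. *)
Lemma lower_bound_square : ~ diag_linked D -> ~ antidiag_linked D ->
  row_linked D -> col_linked D -> 2 * N - 1 <= #|D|.
Proof.
move=> ND NA [[a [b [[A AD [A1 _]] [B BD [B1 _]] _]]] _].
move=> [[c [d [[C CD [_ C2]] [E ED [_ E2]] _]]] _].
by apply: (two_paths_bound eD AD CD (conn AD BD) (conn CD ED) (square_walk ND NA)); near_lia.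
Qed.

(** A quantity preserved by all steps is constant on the connected set [D]; if it determines a cell
    within its column, each column contains at most one cell. *)
Lemma card_le_cx (f : 'I_N * 'I_N -> nat) :
  (forall i j, e i j -> f i = f j) ->
  (forall i j, cx i = cx j -> f i = f j -> cy i = cy j) -> #|D| <= N.
Proof.
move=> ef finj; apply: (@card_le_inj _ _ fst) => i j iD jD /= ij1.
have /finj ij2 : cx i = cx j by rewrite /cx ij1.
rewrite [i]surjective_pairing [j]surjective_pairing ij1; congr pair.
exact/val_inj/ij2/(connect_invariant ef)/conn.
Qed.

Lemma row_linkedVcard : ~ diag_linked D -> ~ antidiag_linked D ->
  row_linked D \/ #|D| <= N.
Proof.
move=> ND NA; have [rl|nrl] := pselect (row_linked D); [by left|right].
have cxe i j : e i j -> cx i = cx j.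
  by move=> /e_linked [->|_ /nrl|[]|_ /ND|_ /NA].
apply: (@card_le_inj _ _ snd) => i j iD jD /= ij2.
rewrite [i]surjective_pairing [j]surjective_pairing ij2; congr pair.
exact/val_inj/(connect_invariant cxe)/conn.
Qed.

Lemma col_linkedVcard : ~ diag_linked D -> ~ antidiag_linked D ->
  col_linked D \/ #|D| <= N.
Proof.
move=> ND NA; have [cl|ncl] := pselect (col_linked D); [by left|right].
apply: (@card_le_cx (@cy N)) => // i j /e_linked.
by case=> [->|[]|_ /ncl|_ /ND|_ /NA].
Qed.

Lemma diag_linkedVcard : ~ antidiag_linked D ->
  (row_linked D \/ col_linked D) \/ #|D| <= N.
Proof.
move=> NA; have [rc|/not_orP[nr nc]] := pselect (row_linked D \/ col_linked D).
  by left.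
right; have ltN (i : 'I_N * 'I_N) : cy i < N := ltn_ord i.2.
(* Only diagonal steps remain, and they preserve the difference of the coordinates; [ltN] makes the
   subtraction exact. *)
apply: (@card_le_cx (fun i => cx i + (N - cy i))) => i j; last first.
  by have := ltN i; have := ltN j; lia.
have := ltN i; have := ltN j => ? ? /e_linked.
by case=> [->|_ /nr|_ /nc|[[]|[]]|_ /NA]//; lia.
Qed.

Lemma antidiag_linkedVcard : ~ diag_linked D ->
  (row_linked D \/ col_linked D) \/ #|D| <= N.
Proof.
move=> ND; have [rc|/not_orP[nr nc]] := pselect (row_linked D \/ col_linked D).
  by left.
right; apply: (@card_le_cx (fun i => cx i + cy i)) => i j; last by lia.
by move=> /e_linked [->|_ /nr|_ /nc|_ /ND|[[]|[]]]//; lia.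
Qed.

Theorem linked_card_lower_bound : N < #|D| -> 2 * N - 1 <= #|D|.
Proof.
rewrite ltnNge => /negP ND.
have [dg|ndg] := pselect (diag_linked D); have [adg|nadg] := pselect (antidiag_linked D).
- exact: lower_bound_full.
- by case: (diag_linkedVcard nadg) => [|/ND//]; exact: lower_bound_diag.
- by case: (antidiag_linkedVcard ndg) => [|/ND//]; exact: lower_bound_antidiag.
- case: (row_linkedVcard ndg nadg) => [rl|/ND//].
  by case: (col_linkedVcard ndg nadg) => [cl|/ND//]; exact: lower_bound_square.
Qed.

End LowerBound.

(** * The attractor and its contact points *)

Local Notation phi := (@gsc_map _ _).

(** Here [c] is the least value of a coordinate on F, attained at the image of a point with
    coordinate [q]. Subtracting [c <= q] from the equation gives c(n - 1) >= i >= 0. *)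
Lemma fixed_bound_ge0 (R : realFieldType) (n c q i : R) :
  (2 <= n -> c * n = q + i -> c <= q -> 0 <= i -> 0 <= c)%R.
Proof.
move=> n2 cE cq i0; have n1 : (0 < n - 1)%R by lra.
by rewrite -(pmulr_lge0 c n1); lra.
Qed.

Lemma fixed_bound_le1 (R : realFieldType) (n c q i : R) :
  (2 <= n -> c * n = q + i -> q <= c -> i <= n - 1 -> c <= 1)%R.
Proof.
move=> n2 cE cq i0; have n1 : (0 < n - 1)%R by lra.
by rewrite -subr_ge0 -(pmulr_lge0 _ n1); lra.
Qed.

Section Attractor.
Context (R : realType) (N : nat) (D : {set 'I_N * 'I_N}) (F : set (R * R)).
Context (N2 : 2 <= N) (attrF : is_gsc_attractor D F).
Local Open Scope ring_scope.

Let NR2 : 2 <= N%:R :> R. Proof. by rewrite ler_nat. Qed.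
Let NR0 : N%:R != 0 :> R. Proof. by rewrite pnatr_eq0; case: N N2. Qed.

Lemma phi1 (i : 'I_N * 'I_N) (p : R * R) : (phi i p).1 * N%:R = p.1 + (cx i)%:R.
Proof. by rewrite divfK. Qed.

Lemma phi2 (i : 'I_N * 'I_N) (p : R * R) : (phi i p).2 * N%:R = p.2 + (cy i)%:R.
Proof. by rewrite divfK. Qed.

Lemma attractor_phi i p : i \in D -> F p -> F (phi i p).
Proof.
move=> iD Fp; have [_ [_ ->]] := attrF.
by exists i => //; exists p.
Qed.

Lemma attractorE p : F p -> exists2 i, i \in D & exists2 q, F q & p = phi i q.
Proof.
have [_ [_ FE]] := attrF; rewrite {1}FE => -[i iD [q Fq <-]].
by exists i => //; exists q.
Qed.

Lemma attractor_min (g : R * R -> R) : continuous g ->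
  exists2 c, F c & forall p, F p -> g c <= g p.
Proof.
move=> cg; have [F0 [cF _]] := attrF.
have [c] := compact_EVT_min F0 cF (continuous_subspaceT cg).
by rewrite inE => Fc minc; exists c => // p Fp; apply: minc; rewrite inE.
Qed.

Lemma cx_le (i : 'I_N * 'I_N) : (cx i)%:R <= N%:R - 1 :> R.
Proof. by rewrite lerBrDr natr1 ler_nat (ltn_ord i.1). Qed.

Lemma cy_le (i : 'I_N * 'I_N) : (cy i)%:R <= N%:R - 1 :> R.
Proof. by rewrite lerBrDr natr1 ler_nat (ltn_ord i.2). Qed.

Lemma attractor_box p : F p -> [/\ 0 <= p.1, p.1 <= 1, 0 <= p.2 & p.2 <= 1].
Proof.
move=> Fp.
have [a /attractorE[i iD [q Fq aE]] mina] := @attractor_min fst (fun=> cvg_fst).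
have [b /attractorE[j jD [r Fr bE]] minb] := @attractor_min snd (fun=> cvg_snd).
have [c /attractorE[k kD [s Fs cE]] minc] :=
  @attractor_min (fun p => - p.1) (fun x => cvgN cvg_fst).
have [d /attractorE[l lD [t Ft dE]] mind] :=
  @attractor_min (fun p => - p.2) (fun x => cvgN cvg_snd).
have := phi1 i q; have := phi2 j r; have := phi1 k s; have := phi2 l t.
rewrite -aE -bE -cE -dE => d2 c1 b2 a1.
have a0 : 0 <= a.1 by apply: fixed_bound_ge0 NR2 a1 (mina _ Fq) _.
have b0 : 0 <= b.2 by apply: fixed_bound_ge0 NR2 b2 (minb _ Fr) _.
have c0 : c.1 <= 1.
  by apply: fixed_bound_le1 NR2 c1 _ (cx_le k); rewrite -lerN2 minc.
have d0 : d.2 <= 1.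
  by apply: fixed_bound_le1 NR2 d2 _ (cy_le l); rewrite -lerN2 mind.
have := mina _ Fp; have := minb _ Fp; have := minc _ Fp; have := mind _ Fp.
by move=> *; split; lra.
Qed.

(** This is the ambiguity of base N expansions: two digits with remainders in [0, 1] agree, or
    differ by one with remainders 0 and 1. *)
Lemma digit_step (u v : R) (a b : nat) :
  0 <= u -> u <= 1 -> 0 <= v -> v <= 1 -> u + a%:R = v + b%:R ->
  [\/ a = b /\ u = v, [/\ a = b.+1, u = 0 & v = 1] | [/\ b = a.+1, u = 1 & v = 0]].
Proof.
move=> u0 u1 v0 v1 uv.
have ab : (a <= b.+1)%N by rewrite -(ler_nat R) -natr1; lra.
have ba : (b <= a.+1)%N by rewrite -(ler_nat R) -natr1; lra.
have [ltab|ltba|eqab] := ltngtP a b.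
- have bE : b = a.+1 by lia.
  by move: uv; rewrite bE -natr1 => uv; apply: Or33; split=> //; lra.
- have aE : a = b.+1 by lia.
  by move: uv; rewrite aE -natr1 => uv; apply: Or32; split=> //; lra.
- by move: uv; rewrite eqab => uv; apply: Or31; split=> //; lra.
Qed.

Lemma digit_at0 (u v : R) (a : nat) : 0 <= u -> v * N%:R = u + a%:R -> v = 0 ->
  u = 0 /\ a = 0.
Proof.
move=> u0 + v0; rewrite v0 mul0r => /esym/eqP.
by rewrite paddr_eq0// pnatr_eq0 => /andP[/eqP ? /eqP ?].
Qed.

Lemma digit_at1 (u v : R) (a : nat) : u <= 1 -> (a%:R <= N%:R - 1 :> R) ->
  v * N%:R = u + a%:R -> v = 1 -> u = 1 /\ a = N.-1.
Proof.
move=> u1 aN + v1; rewrite v1 mul1r => NE; split; first by lra.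
have : a.+1%:R == N%:R :> R by rewrite -natr1 NE; apply/eqP; lra.
by rewrite eqr_nat => /eqP <-.
Qed.

(** The booleans index the four corners of the unit square. An extreme coordinate arises only from
    an extreme digit. *)
Lemma attractor_corner (b1 b2 : bool) : F (b1%:R, b2%:R) ->
  is_cell D (b1 * N.-1) (b2 * N.-1).
Proof.
move=> /[dup] Fb /attractorE[i iD [q Fq bE]]; exists i => //.
have [q1 q1' q2 q2'] := attractor_box Fq.
have := phi1 i q; have := phi2 i q; rewrite -bE /= => e2 e1.
split.
  case: b1 e1 {Fb bE} => /= e1; rewrite ?mul1n ?mul0n.
    by have [] := digit_at1 q1' (cx_le i) e1 erefl.
  by have [] := digit_at0 q1 e1 erefl.
case: b2 e2 {Fb bE} => /= e2; rewrite ?mul1n ?mul0n.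
  by have [] := digit_at1 q2' (cy_le i) e2 erefl.
by have [] := digit_at0 q2 e2 erefl.
Qed.

(** The digits producing the two points lie in the extreme columns and in the same row, unless the
    height is on the common edge of two rows. In that case the rows differ by one, and the preimages
    are opposite corners of the square, whose digits supply the other inequality. *)
Lemma attractor_row_linked (t : R) : F (0, t) -> F (1, t) -> row_linked D.
Proof.
move=> /attractorE[i iD [p Fp iE]] /attractorE[j jD [q Fq jE]].
have [p1 p1' p2 p2'] := attractor_box Fp; have [q1 q1' q2 q2'] := attractor_box Fq.
have := phi1 i p; have := phi2 i p; rewrite -iE /= => i2 i1.
have := phi1 j q; have := phi2 j q; rewrite -jE /= => j2 j1.
have [p10 i0] := digit_at0 p1 i1 erefl.
have [q11 jN] := digit_at1 q1' (cx_le j) j1 erefl.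
have Ci : is_cell D 0 (cy i) by exists i.
have Cj : is_cell D N.-1 (cy j) by exists j.
have pE : (p.1, p.2) = p by case: (p). have qE : (q.1, q.2) = q by case: (q).
rewrite p10 in pE; rewrite q11 in qE.
have [[ij _]|[ij p20 q21]|[ij p21 q20]] := digit_step p2 p2' q2 q2' (etrans (esym i2) j2).
- by split; exists (cy i), (cy j); split=> //; rewrite ij.
- rewrite p20 in pE; rewrite q21 in qE.
  have := @attractor_corner false false; rewrite ?mul0n ?mul1n pE => /(_ Fp) C0.
  have := @attractor_corner true true; rewrite ?mul0n ?mul1n qE => /(_ Fq) C1.
  split; first by exists (cy i), (cy j); split=> //; rewrite ij.
  by exists 0%N, N.-1; split.
- rewrite p21 in pE; rewrite q20 in qE.
  have := @attractor_corner false true; rewrite ?mul0n ?mul1n pE => /(_ Fp) C0.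
  have := @attractor_corner true false; rewrite ?mul0n ?mul1n qE => /(_ Fq) C1.
  split; last by exists (cy i), (cy j); split=> //; rewrite ij.
  by exists N.-1, 0%N; split.
Qed.

Lemma attractor_col_linked (t : R) : F (t, 0) -> F (t, 1) -> col_linked D.
Proof.
move=> /attractorE[i iD [p Fp iE]] /attractorE[j jD [q Fq jE]].
have [p1 p1' p2 p2'] := attractor_box Fp; have [q1 q1' q2 q2'] := attractor_box Fq.
have := phi1 i p; have := phi2 i p; rewrite -iE /= => i2 i1.
have := phi1 j q; have := phi2 j q; rewrite -jE /= => j2 j1.
have [p20 i0] := digit_at0 p2 i2 erefl.
have [q21 jN] := digit_at1 q2' (cy_le j) j2 erefl.
have Ci : is_cell D (cx i) 0 by exists i.
have Cj : is_cell D (cx j) N.-1 by exists j.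
have pE : (p.1, p.2) = p by case: (p). have qE : (q.1, q.2) = q by case: (q).
rewrite p20 in pE; rewrite q21 in qE.
have [[ij _]|[ij p10 q11]|[ij p11 q10]] := digit_step p1 p1' q1 q1' (etrans (esym i1) j1).
- by split; exists (cx i), (cx j); split=> //; rewrite ij.
- rewrite p10 in pE; rewrite q11 in qE.
  have := @attractor_corner false false; rewrite ?mul0n ?mul1n pE => /(_ Fp) C0.
  have := @attractor_corner true true; rewrite ?mul0n ?mul1n qE => /(_ Fq) C1.
  split; first by exists (cx i), (cx j); split=> //; rewrite ij.
  by exists 0%N, N.-1; split.
- rewrite p11 in pE; rewrite q10 in qE.
  have := @attractor_corner true false; rewrite ?mul0n ?mul1n pE => /(_ Fp) C0.
  have := @attractor_corner false true; rewrite ?mul0n ?mul1n qE => /(_ Fq) C1.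
  split; last by exists (cx i), (cx j); split=> //; rewrite ij.
  by exists N.-1, 0%N; split.
Qed.

Lemma attractor_linked i j :
  (phi i @` F) `&` (phi j @` F) !=set0 -> linked D i j.
Proof.
move=> [z [[p Fp pz] [q Fq qz]]].
have := phi1 i p; have := phi2 i p; rewrite pz => i2 i1.
have := phi1 j q; have := phi2 j q; rewrite qz => j2 j1.
have [p1 p1' p2 p2'] := attractor_box Fp; have [q1 q1' q2 q2'] := attractor_box Fq.
have := digit_step p1 p1' q1 q1' (etrans (esym i1) j1).
have := digit_step p2 p2' q2 q2' (etrans (esym i2) j2).
have pE : (p.1, p.2) = p by case: (p). have qE : (q.1, q.2) = q by case: (q).
case=> [[ijy pqy]|[ijy py qy]|[ijy py qy]]; case=> [[ijx pqx]|[ijx px qx]|[ijx px qx]].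
- apply: LinkedRefl; rewrite [i]surjective_pairing [j]surjective_pairing.
  by congr pair; apply: val_inj.
- rewrite px in pE; rewrite qx -pqy in qE.
  apply: LinkedRow; first by split=> //; left.
  by apply: (@attractor_row_linked p.2); rewrite ?pE ?qE.
- rewrite px in pE; rewrite qx -pqy in qE.
  apply: LinkedRow; first by split=> //; right.
  by apply: (@attractor_row_linked p.2); rewrite ?pE ?qE.
- rewrite py in pE; rewrite qy -pqx in qE.
  apply: LinkedCol; first by split=> //; left.
  by apply: (@attractor_col_linked p.1); rewrite ?pE ?qE.
- rewrite px py in pE; rewrite qx qy in qE.
  apply: LinkedDiag; first by left.
  have := @attractor_corner false false; rewrite ?mul0n ?mul1n pE => /(_ Fp) ?.
  by have := @attractor_corner true true; rewrite ?mul0n ?mul1n qE => /(_ Fq).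
- rewrite px py in pE; rewrite qx qy in qE.
  apply: LinkedAntidiag; first by right.
  have := @attractor_corner true false; rewrite ?mul0n ?mul1n pE => /(_ Fp) ?.
  by have := @attractor_corner false true; rewrite ?mul0n ?mul1n qE => /(_ Fq).
- rewrite py in pE; rewrite qy -pqx in qE.
  apply: LinkedCol; first by split=> //; right.
  by apply: (@attractor_col_linked p.1); rewrite ?pE ?qE.
- rewrite px py in pE; rewrite qx qy in qE.
  apply: LinkedAntidiag; first by left.
  have := @attractor_corner false true; rewrite ?mul0n ?mul1n pE => /(_ Fp) ?.
  by have := @attractor_corner true false; rewrite ?mul0n ?mul1n qE => /(_ Fq).
- rewrite px py in pE; rewrite qx qy in qE.
  apply: LinkedDiag; first by right.
  have := @attractor_corner true true; rewrite ?mul0n ?mul1n pE => /(_ Fp) ?.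
  by have := @attractor_corner false false; rewrite ?mul0n ?mul1n qE => /(_ Fq).
Qed.

(** * The graph of touching pieces of a connected attractor *)

Definition touch : rel ('I_N * 'I_N) := fun i j =>
  [&& i \in D, j \in D & `[< (phi i @` F) `&` (phi j @` F) !=set0 >]].

Lemma touch_sym : symmetric touch.
Proof. by move=> i j; rewrite /touch setIC andbCA. Qed.

Lemma phi_continuous (i : 'I_N * 'I_N) : continuous (phi i : R * R -> R * R).
Proof.
move=> x.
have c1 : (phi i y).1 @[y --> x] --> (phi i x).1.
  by apply: cvgMr_tmp; apply: cvgD; [exact: cvg_fst|exact: cvg_cst].
have c2 : (phi i y).2 @[y --> x] --> (phi i x).2.
  by apply: cvgMr_tmp; apply: cvgD; [exact: cvg_snd|exact: cvg_cst].
exact: cvg_pair c1 c2.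
Qed.

Lemma closed_phi_bigcup (S : {pred 'I_N * 'I_N}) :
  closed (\bigcup_(i in [set i | i \in S]) (phi i @` F)).
Proof.
apply: closed_bigcup; first exact: finite_finset.
move=> i _; apply: compact_closed; first exact: norm_hausdorff.
apply: continuous_compact; last by have [_ []] := attrF.
exact/continuous_subspaceT/phi_continuous.
Qed.

(** The pieces in the component of [i] and the remaining pieces have disjoint closed unions that
    cover F, so the first union is all of F. *)
Lemma connected_touch : connected F -> {in D &, forall i j, connect touch i j}.
Proof.
move=> conF i j iD jD; have [[x Fx] [_ FE]] := attrF.
pose piece (S : {pred 'I_N * 'I_N}) := \bigcup_(k in [set k | k \in S]) (phi k @` F).
pose S : {pred 'I_N * 'I_N} := [pred k in D | connect touch i k].
pose S' : {pred 'I_N * 'I_N} := [pred k in D | ~~ connect touch i k].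
have SF : piece S `<=` F.
  by move=> y [k /= /andP[kD _] [p Fp <-]]; apply: attractor_phi.
have : piece S = F.
  apply: conF.
  - by exists (phi i x); exists i; [rewrite /= inE iD connect0|exists x].
  - exists (~` piece S'); first exact/closed_openC/closed_phi_bigcup.
    apply/seteqP; split=> [y|y [Fy nS'y]].
      move=> /[dup] /SF Fy [k /= /andP[kD ik] ky]; split=> // -[l /= /andP[lD il] ly].
      case/negP: il; apply: connect_trans ik (connect1 _).
      by rewrite /touch kD lD; apply/asboolP; exists y.
    have [k kD [q Fq yE]] := attractorE Fy.
    exists k => /=; last by exists q.
    rewrite inE kD; apply/negPn/negP => ik; apply: nS'y.
    by exists k; [rewrite /= inE kD|exists q].
  - by exists (piece S); [exact: closed_phi_bigcup|apply/esym/setIidr].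
(* The point [phi j x] now lies in a piece [k] of the component, and the piece of [j] therefore
   touches that of [k]. *)
move=> /seteqP[_ /(_ (phi j x)) []]; first exact: attractor_phi.
move=> k /= /andP[kD ik] [q Fq qE]; apply: connect_trans ik (connect1 _).
by rewrite /touch kD jD; apply/asboolP; exists (phi j x); split; [exists q|exists x].
Qed.

Theorem connected_card : connected F -> (N < #|D|)%N -> (2 * N - 1 <= #|D|)%N.
Proof.
move=> /connected_touch conn; apply: (linked_card_lower_bound _ conn).
  by move=> i j /and3P[].
by move=> i j /and3P[_ _ /asboolP /attractor_linked].
Qed.

(** * From the graph back to connectedness *)

Lemma phi_dist1 (i : 'I_N * 'I_N) (p q : R * R) :
  `|(phi i p).1 - (phi i q).1| * N%:R = `|p.1 - q.1|.
Proof.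
rewrite -[X in _ * X](ger0_norm (ler0n R N)) -normrM mulrBl !phi1.
by congr `|_|; lra.
Qed.

Lemma phi_dist2 (i : 'I_N * 'I_N) (p q : R * R) :
  `|(phi i p).2 - (phi i q).2| * N%:R = `|p.2 - q.2|.
Proof.
rewrite -[X in _ * X](ger0_norm (ler0n R N)) -normrM mulrBl !phi2.
by congr `|_|; lra.
Qed.

(** A point of F nearest to [c] in the l^1 distance is moved by [phi i] to a point of F at most half
    as far away, so its distance to [c] is 0. *)
Lemma attractor_fixed i c : i \in D -> phi i c = c -> F c.
Proof.
move=> iD ic.
have cg : continuous (fun p : R * R => `|p.1 - c.1| + `|p.2 - c.2|).
  move=> x; apply: cvgD; apply: cvg_norm; apply: cvgB;
    by [exact: cvg_fst|exact: cvg_snd|exact: cvg_cst].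
have [p Fp /(_ (phi i p) (attractor_phi iD Fp)) minp] := attractor_min cg.
have := phi_dist1 i p c; have := phi_dist2 i p c; rewrite ic => d2 d1.
have n1 := normr_ge0 ((phi i p).1 - c.1); have n2 := normr_ge0 ((phi i p).2 - c.2).
have m1 : `|(phi i p).1 - c.1| * 2 <= `|p.1 - c.1| by rewrite -d1 ler_wpM2l.
have m2 : `|(phi i p).2 - c.2| * 2 <= `|p.2 - c.2| by rewrite -d2 ler_wpM2l.
have /eqP := @erefl R (`|p.1 - c.1|); rewrite {1}(_ : `|p.1 - c.1| = 0); last by lra.
rewrite eq_sym normr_eq0 subr_eq0 => /eqP pc1.
have /eqP := @erefl R (`|p.2 - c.2|); rewrite {1}(_ : `|p.2 - c.2| = 0); last by lra.
rewrite eq_sym normr_eq0 subr_eq0 => /eqP pc2.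
by rewrite [c]surjective_pairing -pc1 -pc2 -surjective_pairing.
Qed.

Lemma corner_attractor (b1 b2 : bool) :
  is_cell D (b1 * N.-1) (b2 * N.-1) -> F (b1%:R, b2%:R).
Proof.
have bE (b : bool) : (b%:R + (b * N.-1)%:R) / N%:R = b%:R :> R.
  case: b; last by rewrite mul0n addr0 mul0r.
  by rewrite mul1n -natrD add1n prednK ?divff//; case: N N2.
case=> i iD [i1 i2]; apply: (attractor_fixed iD).
by rewrite /gsc_map/= -/(cx i) -/(cy i) i1 i2 !bE.
Qed.

(** Relatively clopen subsets of the compact F have this property for small [eps], and unlike
    openness it comes with a scale to induct on. *)
Definition saturated (eps : R) (B : set (R * R)) : Prop :=
  forall p q, F p -> F q -> `|p.1 - q.1| < eps -> `|p.2 - q.2| < eps -> B p -> B q.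

Lemma saturated_full : {in D &, forall i j, connect touch i j} ->
  forall n (eps : R) B, 1 < eps * N%:R ^+ n -> saturated eps B ->
  forall x, F x -> B x -> F `<=` B.
Proof.
move=> conn.
have N0 : 0 < N%:R :> R by rewrite ltr0n ltnW.
elim=> [|n IHn] eps B epsn satB x Fx Bx y Fy.
  (* Now [eps] exceeds 1, and F lies in the unit square, so any two of its points are one move
     apart. *)
  rewrite expr0 mulr1 in epsn.
  have [x1 x1' x2 x2'] := attractor_box Fx.
  have [y1 y1' y2 y2'] := attractor_box Fy.
  apply: (satB x) => //; apply: le_lt_trans epsn; rewrite ler_norml; lra.
(* The preimage of [B] under [phi i] is saturated at the scale [eps * N%:R], to which the induction
   hypothesis applies. *)
have piece i p : i \in D -> F p -> B (phi i p) -> forall q, F q -> B (phi i q).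
  move=> iD Fp Bp; apply: (IHn (eps * N%:R) (fun q => B (phi i q)) _ _ p) => //.
    by rewrite -mulrA -exprS.
  move=> q r Fq Fr qr1 qr2.
  have Fphi s : F s -> F (phi i s) by exact: (attractor_phi iD).
  apply: (satB (phi i q)); [exact: Fphi|exact: Fphi| |].
    by rewrite -(ltr_pM2r (x := N%:R)) ?phi_dist1.
  by rewrite -(ltr_pM2r (x := N%:R)) ?phi_dist2.
have touch_piece i j : touch i j ->
    (forall q, F q -> B (phi i q)) -> forall q, F q -> B (phi j q).
  move=> /and3P[iD jD /asboolP[z [[p Fp pz] [q Fq qz]]]] Bi.
  by apply: (piece j q) => //; rewrite qz -pz; exact: Bi.
have [i iD [p Fp xE]] := attractorE Fx.
have [j jD [q Fq ->]] := attractorE Fy.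
have Bi : forall r, F r -> B (phi i r) by apply: (piece i p); rewrite -?xE.
have /connectP[s + ->] := conn _ _ iD jD.
elim: s i Bi {iD xE} => [|k s IHs] i Bi /= => [_|/andP[ik ks]]; first exact: Bi.
by apply: IHs ks; exact: touch_piece Bi.
Qed.

Lemma touch_connected : {in D &, forall i j, connect touch i j} -> connected F.
Proof.
move=> conn B [x Bx] [C oC BC] [C' cC' BC'].
have [_ [cF _]] := attrF.
have cB : compact B by rewrite BC'; exact: compact_closedI.
(* Local form of a Lebesgue number: one radius must serve all points near [p]. Compactness of [B]
   makes it uniform. *)
have oB p : B p -> \forall q \near p & e \near 0^'+, ball q e `<=` C.
  rewrite BC => -[_ Cp].
  have /nbhs_ballP[e /= e0 eC] : nbhs p C by apply: open_nbhs_nbhs.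
  exists (ball p (e / 2), [set r | r < e / 2]).
    split; first by apply: nbhsx_ballx; rewrite divr_gt0.
    by apply: nbhs_right_lt; rewrite divr_gt0.
  move=> [q r] /= [pq re] z qz; apply: eC; rewrite (splitr e).
  by apply: ball_triangle pq _; exact: le_ball (ltW re) _ qz.
have near_C : \forall e \near 0^'+, B `<=` (fun p => ball p e `<=` C).
  by apply: (compact_near_coveringP B).1 => //; exact: oB.
have [e [eC e0]] := filter_ex (filterI near_C (nbhs_right_gt 0)).
apply/seteqP; split; first by rewrite BC => y [].
(* The exponent n exceeds 1 / e, and N ^ n > n. *)
have ltNn : 1 < e * N%:R ^+ (Num.truncn e^-1).+1.
  rewrite mulrC -ltr_pdivrMr// div1r; apply: lt_trans (truncnS_gt _) _.
  by rewrite -natrX ltr_nat ltn_expl.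
apply: (saturated_full conn ltNn _ (x := x)) => //; last by move: Bx; rewrite BC => -[].
by move=> p q Fp Fq pq1 pq2 Bp; rewrite BC; split=> //; apply: (eC p Bp); split.
Qed.

(** * Connected attractors from left-closed digit sets *)

Lemma touch_right_neighbour i j : F (0, 0) -> F (1, 0) -> i \in D -> j \in D ->
  cy i = cy j -> cx i = (cx j).+1 -> touch i j.
Proof.
move=> F00 F10 iD jD ijy ijx; apply/and3P; split=> //; apply/asboolP.
exists (phi i (0, 0)); split; first by exists (0, 0).
exists (1, 0) => //; rewrite /gsc_map /= -/(cx i) -/(cx j) -/(cy i) -/(cy j).
by rewrite ijx ijy -natr1; congr ((_ / _), _); lra.
Qed.

Lemma touch_upper_neighbour i j : F (0, 0) -> F (0, 1) -> i \in D -> j \in D ->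
  cx i = cx j -> cy i = (cy j).+1 -> touch i j.
Proof.
move=> F00 F01 iD jD ijx ijy; apply/and3P; split=> //; apply/asboolP.
exists (phi i (0, 0)); split; first by exists (0, 0).
exists (0, 1) => //; rewrite /gsc_map /= -/(cx i) -/(cx j) -/(cy i) -/(cy j).
by rewrite ijx ijy -natr1; congr (_, (_ / _)); lra.
Qed.

Lemma left_closed_connected : left_closed D -> bottom_row N \subset D ->
  left_column N \subset D \/ D \subset bottom_row N -> connected F.
Proof.
move=> lD /fintype.subsetP bD colD; apply: touch_connected.
have N0 : (0 < N)%N by exact: ltnW.
pose z : 'I_N := Ordinal N0.
have N1 : (N.-1 < N)%N by rewrite prednK.
have zzD : (z, z) \in D by apply: bD; rewrite inE.
have F00 : F (0, 0).
  by apply: (@corner_attractor false false); exists (z, z).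
have F10 : F (1, 0).
  apply: (@corner_attractor true false); exists (Ordinal N1, z).
    by apply: bD; rewrite inE.
  by rewrite mul1n mul0n.
have row n i : i \in D -> cx i = n -> connect touch i (z, i.2).
  elim: n i => [|n IHn] i iD ni.
    suff -> : (z, i.2) = i by [].
    by rewrite [in RHS](surjective_pairing i); congr pair; apply/val_inj/esym.
  have nN : (n < N)%N by rewrite -ltnS -ni ltnW ?ltnS//; exact: ltn_ord.
  pose j := (Ordinal nN, i.2).
  have jD : j \in D by apply: lD iD _ _; rewrite // ni /cx.
  apply: (connect_trans (connect1 _) (IHn j jD erefl)).
  exact: touch_right_neighbour.
have col n i : i \in D -> cx i = 0%N -> cy i = n -> connect touch i (z, z).
  case: colD => [/fintype.subsetP cD|/fintype.subsetP Db]; last first.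
    move=> iD i0 _; have := Db _ iD; rewrite inE => /eqP i0'.
    suff -> : (z, z) = i by [].
    by rewrite [in RHS](surjective_pairing i); congr pair; apply/val_inj/esym.
  have F01 : F (0, 1).
    apply: (@corner_attractor false true); exists (z, Ordinal N1).
      by apply: cD; rewrite inE.
    by rewrite mul1n mul0n.
  elim: n i => [|n IHn] i iD i0 ni.
    suff -> : (z, z) = i by [].
    by rewrite [in RHS](surjective_pairing i); congr pair; apply/val_inj/esym.
  have nN : (n < N)%N by rewrite -ltnS -ni ltnW ?ltnS//; exact: ltn_ord.
  pose j := (z, Ordinal nN).
  have jD : j \in D by apply: cD; rewrite inE.
  apply: (connect_trans (connect1 _) (IHn j jD erefl erefl)).
  exact: touch_upper_neighbour.
have to_zz i : i \in D -> connect touch i (z, z).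
  move=> iD; apply: connect_trans (row _ i iD erefl) _; apply: col => //.
  have [i0|i0] := posnP (cx i).
    suff -> : (z, i.2) = i by [].
    by rewrite [in RHS](surjective_pairing i); congr pair; apply/val_inj/esym.
  by apply: lD iD _ _.
move=> i j iD jD; apply: connect_trans (to_zz i iD) _.
by rewrite (sym_connect_sym touch_sym) to_zz.
Qed.

End Attractor.

Unset Implicit Arguments.

Theorem mainTheorem6 (R : realType) (N : nat) (HN : (2 <= N)%N) :
  (forall (D : {set 'I_N * 'I_N}) (F : set (R * R)),
      gsc_digits D -> @is_gsc_attractor R N D F -> connected F ->
      (N < #|D|)%N -> (2 * N - 1 <= #|D|)%N)
  /\
  (forall k : nat, ((2 * N - 1 <= k)%N /\ (k <= N ^ 2 - 1)%N) \/ k = N ->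
      exists D : {set 'I_N * 'I_N},
        gsc_digits D /\ #|D| = k /\
        forall F : set (R * R), @is_gsc_attractor R N D F -> connected F).
Proof.
split=> [D F _ attrF conF|k]; first exact: (connected_card HN attrF conF).
have N0 : (0 < N)%N by exact: ltnW.
have NN : (N < N ^ 2)%N by rewrite -[X in (X < _)%N]expn1 ltn_exp2l.
case=> [[kN Nk]|->]; last first.
  exists (bottom_row N); rewrite /gsc_digits card_bottom_row//; do 2!split=> //.
  move=> F attrF; apply: (left_closed_connected HN attrF (@left_closed_bottom_row N)) => //.
  by right.
have [|D [lD bD cD Dk]] := left_closed_exists N0 kN; first by lia.
exists D; rewrite /gsc_digits Dk; split; first by lia.
split=> // F attrF; apply: (left_closed_connected HN attrF lD bD).
by left.
Qed.
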